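(* For every $k\ge2$ there is a constant $C_k$, depending only on $k$, such that for every finite graph $G$ with pathwidth $k$ and every metric $d_w$ supported on $G$, $\mathsf{La}((G,d_w))$ bi-Lipschitzly embeds into $L_1$ with distortion at most $C_k$.
   Context: The pathwidth of a graph is the minimum width over all its path decompositions (tree decompositions whose underlying tree is a path; the width is the maximal bag size minus one). A metric $d_w$ is supported on a graph $G=(V,E)$ if it is the shortest path metric on $V$ with respect to some weight function $w\colon E\to[0,\infty)$ (always assumed reduced: $d_w(x,y)=w((x,y))$ for $(x,y)\in E$). $(G,d_w)$ denotes the metric space $(V,d_w)$. For a finite metric space $(X,d_X)$, points $x,y\in X$ and $C\subset X$, $\mathrm{tsp}_X(x,C,y)$ is the minimum of $\sum_{i=1}^n d_X(x_{i-1},x_i)$ over all finite sequences $x_0,\dots,x_n$ ($n\ge0$) in $X$ with $x_0=x$, $x_n=y$, $C\subset\{x_0,\dots,x_n\}$. The lamplighter metric space $\mathsf{La}(X)$ is the set of pairs $(A,x)$, with $A$ a finite subset of $X$ and $x\in X$, with the metric $d_{\mathsf{La}(X)}((A,x),(B,y))=\mathrm{tsp}_X(x,A\triangle B,y)+|A\triangle B|$. A metric space $(M,d_M)$ bi-Lipschitzly embeds into $L_1$ with distortion at most $D$ if there are $s>0$ and $f\colon M\to L_1$ with $s\,d_M(x,y)\le\|f(x)-f(y)\|_1\le D s\,d_M(x,y)$ for all $x,y\in M$. *)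

(* Defs.v *)
(* MathComp / MathComp-Analysis *)
From HB Require Import structures.
From mathcomp Require Import all_boot all_order all_algebra.
From mathcomp Require Import all_classical all_reals all_analysis.

Set Implicit Arguments.
Unset Strict Implicit.
Unset Printing Implicit Defensive.
Import Order.TTheory GRing.Theory Num.Theory.

Local Open Scope classical_set_scope.
Local Open Scope ring_scope.

Section Pathwidth.
Variables (T : finType) (e : rel T).

(* A decomposition over the path 0 - 1 - ... - (size P).-1, given by the list
   of its bags; by the third clause the nodes whose bags contain a given vertex
   form a subpath. *)
Definition path_decomposition (P : seq {set T}) : Prop :=
  [/\ forall x, exists2 B, B \in P & x \in B,
      forall x y, e x y -> exists B, [/\ B \in P, x \in B & y \in B] &
      forall i j l, (i <= j <= l)%N -> (l < size P)%N ->
        nth finset.set0 P i :&: nth finset.set0 P l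
          \subset nth finset.set0 P j].

(* Truncated at 0, which only affects the graph without vertices. *)
Definition width (P : seq {set T}) : nat := (\max_(B <- P) #|B|).-1.

Lemma ex_path_decomposition :
  exists n, `[< exists2 P, path_decomposition P & width P = n >].
Proof.
exists (width [:: finset.setT]); apply/asboolP; exists [:: finset.setT] => //.
split=> [x|x y _|i j [|//] /andP[ij]].
- by exists finset.setT; rewrite ?mem_head ?finset.in_setT.
- by exists finset.setT; rewrite mem_head !finset.in_setT.
- by rewrite leqn0 => /eqP j0; rewrite j0 subsetIr.
Qed.

Definition pathwidth : nat := ex_minn ex_path_decomposition.

End Pathwidth.

Section Metrics.
Variable R : realType.

Definition is_metric (M : Type) (d : M -> M -> R) : Prop :=
  [/\ forall x, d x x = 0,
      forall x y, d x y = 0 -> x = y,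
      forall x y, d x y = d y x &
      forall x y z, d x z <= d x y + d y z].

(* The sum of f over the consecutive pairs of the sequence x :: s. *)
Fixpoint walk_length (T : Type) (f : T -> T -> R) (x : T) (s : seq T) : R :=
  if s is y :: s' then f x y + walk_length f y s' else 0.

(* d x y is the minimal w-length of an e-path from x to y; in particular every
   two vertices are joined by an e-path. *)
Definition shortest_path_dist (T : finType) (e : rel T) (w d : T -> T -> R) :=
  forall x y,
    (exists s, [/\ path e x s, last x s = y & walk_length w x s = d x y]) /\
    (forall s, path e x s -> last x s = y -> d x y <= walk_length w x s).

(* Only the values of w on edges are relevant. The last clause says that w is
   reduced. *)
Definition supported_on (T : finType) (e : rel T) (d : T -> T -> R) : Prop :=
  exists w : T -> T -> R,
    [/\ forall x y, e x y -> 0 <= w x y,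
        forall x y, e x y -> w x y = w y x,
        shortest_path_dist e w d &
        forall x y, e x y -> d x y = w x y].

Section Lamplighter.
Variables (T : finType) (d : T -> T -> R).

(* The sequence x_0, ..., x_n is x :: s. For a metric d the infimum is a
   minimum, see tsp_min. *)
Definition tsp (x : T) (C : {set T}) (y : T) : R :=
  inf [set walk_length d x s | s in
        [set s : seq T | last x s = y /\ {subset C <= x :: s}]].

Definition symdiff (A B : {set T}) : {set T} := (A :\: B) :|: (B :\: A).

Definition la_dist (p q : {set T} * T) : R :=
  tsp p.2 (symdiff p.1 q.1) q.2 + #|symdiff p.1 q.1|%:R.

Lemma tsp_min (x : T) (C : {set T}) (y : T) : is_metric d ->
  (exists s, [/\ last x s = y, {subset C <= x :: s} &
                 walk_length d x s = tsp x C y]) /\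
  (forall s, last x s = y -> {subset C <= x :: s} ->
     tsp x C y <= walk_length d x s).
Proof.
case=> d0 _ dC dtri.
have d_ge0 u v : 0 <= d u v.
  by have := dtri u v u; rewrite d0 (dC v u) -mulr2n pmulrn_lge0.
have len_rcons z t s u : subseq t s ->
    walk_length d u (rcons t z) <= walk_length d u (rcons s z).
  elim: s t u => [|a s IH] t u; first by rewrite subseq0 => /eqP->.
  case: t => [_|b t] /=.
    rewrite addr0; apply: le_trans (dtri u a z) _; rewrite lerD2l.
    by have := IH [::] a (sub0seq _); rewrite /= addr0; apply.
  case: eqP => [-> /IH le_ts|_ /(IH _ u) le_ts]; first by rewrite lerD2l.
  apply: le_trans le_ts _; case: (s) => [|c s'] /=;
    by rewrite addrA lerD2r.
pose Q (s : seq T) := (last x s == y) && (C \subset x :: s).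
have QP s : Q s <-> last x s = y /\ {subset C <= x :: s}.
  by split=> [/andP[/eqP ? /fintype.subsetP]|[? ?]] //; apply/andP; split;
    [apply/eqP|apply/fintype.subsetP].
have short s : Q s -> exists t : {bseq (#|T|.+1) of T},
    Q t /\ walk_length d x t <= walk_length d x s.
  case/lastP: s => [|s z] Qs; first by exists [bseq].
  have sz : (size (rcons (undup s) z) <= #|T|.+1)%N.
    by rewrite size_rcons ltnS -(card_uniqP (undup_uniq s)) max_card.
  exists (Bseq sz); split; last exact/len_rcons/undup_subseq.
  move: Qs; rewrite /Q /= !last_rcons => /andP[-> /fintype.subsetP CS] /=.
  apply/fintype.subsetP => c /CS; rewrite !(inE, mem_rcons) mem_undup.
  by [].
have [t0 [Qt0 _]] : exists t : {bseq (#|T|.+1) of T}, Q t /\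
    walk_length d x t <= walk_length d x (rcons (enum C) y).
  apply: short; rewrite /Q last_rcons eqxx /=; apply/fintype.subsetP => c cC.
  by rewrite !(inE, mem_rcons) mem_enum cC !orbT.
pose Qb : pred {bseq (#|T|.+1) of T} := fun t => Q t.
pose len (t : {bseq (#|T|.+1) of T}) := walk_length d x t.
case: (@arg_minP _ R _ t0 Qb len Qt0) => m Qm m_min.
have lb s : Q s -> walk_length d x m <= walk_length d x s.
  by move=> /short[t [/m_min mt ts]]; exact: le_trans ts.
have tspE : tsp x C y = walk_length d x m.
  apply/eqP; rewrite eq_le; apply/andP; split.
    apply: ge_inf; last by exists (m : seq T) => //; exact/QP.
    by exists (walk_length d x m) => _ [s /QP /lb ? <-].
  apply: lb_le_inf.
    by exists (walk_length d x m), (m : seq T) => //; exact/QP.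
  by move=> _ [s /QP /lb ? <-].
rewrite tspE; split; last by move=> s sy sC; apply: lb; apply/QP.
by have /QP[? ?] := Qm; exists m.
Qed.

End Lamplighter.

(* L_1 is L_1([0, 1]): the restriction to [0, 1] of the Lebesgue measure is
   seen as a measure on R. *)
Definition lebesgue01 : {measure set (measurableTypeR R) -> \bar R} :=
  mrestr (@lebesgue_measure R) (measurable_itv `[0 : R, 1 : R]).

(* A map into L_1 is given by a choice of representatives; the L_1 distance
   does not depend on it. *)
Definition embeds_L1 (M : Type) (d : M -> M -> R) (D : R) : Prop :=
  exists (s : R) (f : M -> (measurableTypeR R -> R)),
    [/\ 0 < s,
        forall x, f x \in Lfun lebesgue01 1%E &
        forall x y,
          ((s * d x y)%:E <= 'N[lebesgue01]_1 [EFin \o (f x \- f y)%R])%E /\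
          ('N[lebesgue01]_1 [EFin \o (f x \- f y)%R] <= (D * s * d x y)%:E)%E].

End Metrics.

(* Main.v *)
Require Import Defs.
From mathcomp Require Import all_boot all_order all_algebra.
From mathcomp Require Import all_classical all_reals all_analysis.
From mathcomp Require Import measurable_realfun ring lra zify.

(* If random trees on the vertex set have metrics that dominate d and average
   to at most K d, then La(G, d) embeds into L_1 with distortion 3 K. Indeed, an
   edge of a tree T cuts the vertices into two sides; map (A, x) to the side of
   x together with the lamps of A on the other side. The codes of (A, x) and
   (B, y) differ exactly when the edge separates two points among x, y and the
   symmetric difference of A and B, that is, when it belongs to their Steiner
   tree in T, and the length of the Steiner tree is tsp_T up to a factor of 3.
   Weighted sums of discrete metrics embed into L_1.

   Random trees for pathwidth k are built by induction on k. Spread G over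
   layers, one for each bag, with one copy of each vertex in every bag that
   contains it. Let P be a shortest path among those that visit each layer once,
   in order; it is a geodesic, and removing it lowers the number of points per
   layer. Let h be the distance to P. A random tree for the rest is cut at random
   such that the edge above a is cut with probability O(len a / h a) and every
   piece has its root within distance h a of each of its points a; each piece is
   then attached to P by an edge from its root to the nearest point of P. An edge
   that is cut is stretched to length O(h), so the expected stretch is multiplied
   by a constant. *)

Set Implicit Arguments.
Unset Strict Implicit.
Unset Printing Implicit Defensive.
Import Order.TTheory GRing.Theory Num.Theory.

Local Open Scope ring_scope.

(** * Tree metrics *)

Section Pseudometric.
Variables (R : realType) (X : Type).

Definition pseudometric (d : X -> X -> R) : Prop :=
  [/\ forall x, d x x = 0,
      forall x y, d x y = d y x &
      forall x y z, d x z <= d x y + d y z].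

Lemma pseudometric_ge0 (d : X -> X -> R) x y : pseudometric d -> 0 <= d x y.
Proof.
by case=> d0 dC dtri; have := dtri x y x; rewrite d0 (dC y x); lra.
Qed.

Lemma metric_pseudometric (d : X -> X -> R) : is_metric d -> pseudometric d.
Proof. by case. Qed.

Lemma pseudometric_sum (J : finType) (d : J -> X -> X -> R) :
  (forall j, pseudometric (d j)) ->
  pseudometric (fun x y => \sum_j d j x y).
Proof.
move=> pd; split=> [x|x y|x y z].
- by apply: big1 => j _; case: (pd j).
- by apply: eq_bigr => j _; case: (pd j).
- by rewrite -big_split; apply: ler_sum => j _; case: (pd j) => /=.
Qed.

End Pseudometric.

Lemma pseudometric_comp (R : realType) (X Y : Type) (f : Y -> X) (d : X -> X -> R) :
  pseudometric d -> pseudometric (fun u v => d (f u) (f v)).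
Proof. by case=> d0 dC dtri; split=> *. Qed.

Section Trees.
Variables (R : realType) (X : finType).
Implicit Types (U : {set X}) (p : X -> X) (d : X -> X -> R).

(* p is a parent map; the root is its own parent. *)
Definition is_tree U p : Prop :=
  (exists f : X -> nat, forall v, v \in U ->
     p v \in U /\ (p v <> v -> (f (p v) < f v)%N)) /\
  (forall u v, u \in U -> v \in U -> p u = u -> p v = v -> u = v).

(** [fconnect p u a] says that [a] is an ancestor of [u], so the sum runs over the edges from [a] to
    [p a] with exactly one of [u], [v] below them: the edges of the tree path. For a pseudometric
    the root contributes 0. *)
Definition tree_dist U p d (u v : X) : R :=
  \sum_(a in U) d a (p a) * (fconnect p u a != fconnect p v a)%:R.

Lemma fconnectE p u a : fconnect p u a = (u == a) || fconnect p (p u) a.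
Proof.
apply/idP/orP => [/iter_findex <-|[/eqP->|pua]].
- case: (findex p u a) => [|n]; first by left.
  by right; rewrite iterSr; apply: fconnect_iter.
- exact: connect0.
- exact: connect_trans (fconnect1 p u) pua.
Qed.

Lemma fconnect_fixed p u a : p u = u -> fconnect p u a = (u == a).
Proof.
move=> pu; apply/idP/eqP => [/iter_findex <-|->]; last exact: connect0.
by elim: (findex _ _ _) => //= n <-.
Qed.

Lemma tree_dist_pseudometric U p d : pseudometric d ->
  pseudometric (tree_dist U p d).
Proof.
move=> pd; split=> [x|x y|x y z].
- by apply: big1 => a _; rewrite eqxx mulr0.
- by apply: eq_bigr => a _; rewrite eq_sym.
rewrite -big_split; apply: ler_sum => a _ /=; rewrite -mulrDr.
apply: ler_wpM2l; first exact: pseudometric_ge0.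
by rewrite -natrD ler_nat; case: (fconnect p x a) (fconnect p y a)
  (fconnect p z a) => [] [] [].
Qed.

Section TreeFacts.
Variables (U : {set X}) (p : X -> X) (f : X -> nat).
Hypothesis fP : forall v, v \in U ->
  p v \in U /\ (p v <> v -> (f (p v) < f v)%N).
Hypothesis root_uniq :
  forall u v, u \in U -> v \in U -> p u = u -> p v = v -> u = v.

Lemma tree_ancestor v a : v \in U -> fconnect p v a ->
  a \in U /\ (f a <= f v)%N.
Proof.
move=> vU /iter_findex <-; elim: (findex _ _ _) => [|n [IH1 IH2]]//=.
have [pU lt_p] := fP IH1; split => //.
have [-> //|/eqP /lt_p/ltnW le_p] := eqVneq (p (iter n p v)) (iter n p v).
exact: leq_trans le_p IH2.
Qed.

Lemma tree_parentF v : v \in U -> p v <> v -> fconnect p (p v) v = false.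
Proof.
move=> vU pv; apply/negP => /(tree_ancestor (fP vU).1)[_].
by rewrite leqNgt (fP vU).2.
Qed.

Lemma tree_root v : v \in U -> exists2 r, fconnect p v r & p r = r.
Proof.
move: {2}(f v).+1 (ltnSn (f v)) => n; elim: n v => // n IH v le_n vU.
have [pv|/eqP pv] := eqVneq (p v) v; first by exists v.
have [|r vr pr] := IH (p v) _ (fP vU).1.
  exact: leq_trans ((fP vU).2 pv) _.
by exists r => //; rewrite fconnectE vr orbT.
Qed.

Lemma tree_root_ancestor u v : u \in U -> v \in U -> p u = u -> fconnect p v u.
Proof.
move=> uU vU pu; have [r vr pr] := tree_root vU.
by have [rU _] := tree_ancestor vU vr; rewrite (root_uniq uU rU pu pr).
Qed.

Lemma tree_ancestor_lt u v : v \in U -> u <> v -> fconnect p v u ->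
  (f u < f v)%N.
Proof.
move=> vU uv; rewrite fconnectE => /orP[/eqP vu|]; first by case: uv.
have [pv|/eqP pv] := eqVneq (p v) v.
  by rewrite pv fconnect_fixed // => /eqP vu; case: uv.
by case/(tree_ancestor (fP vU).1) => _ /leq_ltn_trans -> //; apply: (fP vU).2.
Qed.

Lemma tree_dist_parent d u v : u \in U -> ~~ fconnect p v u ->
  v \in U -> tree_dist U p d u v = d u (p u) + tree_dist U p d (p u) v.
Proof.
move=> uU vu vU; have pu : p u <> u.
  by move=> pu; move: vu; rewrite tree_root_ancestor.
rewrite /tree_dist (bigD1 u) //= [in RHS](bigD1 u) //= connect0 (negbTE vu).
rewrite tree_parentF //= mulr1 mulr0 add0r; congr (_ + _).
by apply: eq_bigr => a /andP[_ au]; rewrite (fconnectE p u) [u == a]eq_sym (negbTE au).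
Qed.

(* A tree metric is the largest pseudometric with given edge lengths. *)
Lemma le_tree_dist d (K : R) (s : X -> X -> R) : pseudometric s ->
  (forall a, a \in U -> s a (p a) <= K * d a (p a)) ->
  forall u v, u \in U -> v \in U -> s u v <= K * tree_dist U p d u v.
Proof.
move=> [s0 sC str] sK u v.
move: {2}(f u + f v).+1 (ltnSn (f u + f v)) => n; elim: n u v => // n IH.
(* An endpoint [u] that is not an ancestor of [v] moves up one edge; this lowers [f u + f v]. *)
have step u v : (f u + f v < n.+1)%N -> u \in U -> v \in U ->
    ~~ fconnect p v u -> s u v <= K * tree_dist U p d u v.
  move=> le_n uU vU vu; rewrite tree_dist_parent // mulrDr.
  apply: le_trans (str _ (p u) _) _; apply: lerD; first exact: sK.
  have pu : p u <> u by move=> pu; move: vu; rewrite tree_root_ancestor.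
  rewrite ltnS in le_n; apply: IH => //; last exact: (fP uU).1.
  by apply: leq_trans le_n; rewrite ltn_add2r (fP uU).2.
move=> u v le_n uU vU.
have [<-|/eqP uv] := eqVneq u v.
  by rewrite s0 /tree_dist big1 ?mulr0// => a _; rewrite eqxx mulr0.
have [vu|vu] := boolP (fconnect p v u); last exact: step.
rewrite sC; have -> : tree_dist U p d u v = tree_dist U p d v u.
  by apply: eq_bigr => a _; rewrite eq_sym.
apply: step => //; first by rewrite addnC.
apply/negP => /(tree_ancestor_lt uU) vltu.
have := tree_ancestor_lt vU uv vu; rewrite ltnNge ltnW //; apply: vltu.
by move/esym.
Qed.

End TreeFacts.

Lemma tree_dist_edge U p d a : pseudometric d -> is_tree U p -> a \in U ->
  tree_dist U p d a (p a) <= d a (p a).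
Proof.
move=> pd [[f fP] ru] aU; have [d0 _ _] := pd.
have [pa|/eqP pa] := eqVneq (p a) a.
  by rewrite pa d0 /tree_dist big1 // => b _; rewrite eqxx mulr0.
rewrite (tree_dist_parent fP) //; last exact: (fP _ aU).1.
  by rewrite /tree_dist big1 ?addr0 // => b _; rewrite eqxx mulr0.
by rewrite (tree_parentF fP).
Qed.

End Trees.

(** * Attaching a randomly cut tree to a path *)

(** Hermite's identity: passing from m to m + 1 drops the summand m / N and gains (m + N) / N = m /
    N + 1. *)
Lemma sum_divn_shift (N m : nat) : (0 < N)%N ->
  (\sum_(t < N) (m + t) %/ N = m)%N.
Proof.
case: N => // N _; elim: m => [|m IH].
  by apply: big1 => t _; rewrite add0n divn_small.
rewrite big_ord_recr /= addSnnS divnDr ?dvdnn // divnn /= addn1 addnS.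
rewrite -[in RHS]IH [in RHS]big_ord_recl addn0 addnC; congr (_ + _).+1%N.
by apply: eq_bigr => t _; rewrite /= /bump addSnnS.
Qed.

(** Each indicator is at most the increase of the quotient, and by Hermite's identity the increases
    add up to c. So a uniform shift separates m from m + c with probability at most c / N. *)
Lemma card_divn_shift_neq (N m c : nat) : (0 < N)%N ->
  (\sum_(t < N) ((m + c + t) %/ N != (m + t) %/ N) <= c)%N.
Proof.
move=> N0; rewrite -(leq_add2r m) (addnC c) -[X in (_ <= X)%N](sum_divn_shift _ N0).
rewrite -[X in (_ + X)%N](sum_divn_shift m N0) -big_split /=.
apply: leq_sum => t _.
have : ((m + t) %/ N <= (m + c + t) %/ N)%N.
  by apply: leq_div2r; rewrite -addnA leq_add2l leq_addl.
by case: ltngtP => [lt_q _|//|-> _]; rewrite ?eqxx //.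
Qed.

Lemma divn_eq_ltn_sub (N m n : nat) : (0 < N)%N -> (n <= m)%N ->
  (m %/ N = n %/ N)%N -> (m - n < N)%N.
Proof.
move=> N0 le_nm q; rewrite (divn_eq m N) (divn_eq n N) q subnDl.
exact: leq_ltn_trans (leq_subr _ _) (ltn_pmod _ N0).
Qed.

Section Attach.
Variables (R : realType) (X : finType) (rho : X -> X -> R).
Hypothesis prho : pseudometric rho.
Variables (U P : {set X}) (q p : X -> X) (pi : X -> X) (N : nat).
Let h v := rho v (pi v).
Hypothesis PU : P \subset U.
Hypothesis treeP : is_tree P q.
Hypothesis geodP :
  forall a b, a \in P -> b \in P -> tree_dist P q rho a b <= rho a b.
Hypothesis treeW : is_tree (U :\: P) p.
Hypothesis piP : forall v, v \in U -> pi v \in P.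
Hypothesis h_min : forall v b, b \in P -> h v <= rho v b.
Hypothesis N_gt0 : (0 < N)%N.
Hypothesis N_big : forall a b, 0 < rho a b -> h a <= N%:R * rho a b.

Let len v := rho v (p v).

Let rho0 x : rho x x = 0. Proof. by case: prho. Qed.
Let rhoC x y : rho x y = rho y x. Proof. by case: prho. Qed.
Let rhotri x y z : rho x z <= rho x y + rho y z. Proof. by case: prho. Qed.
Let rho_ge0 x y : 0 <= rho x y. Proof. exact: pseudometric_ge0. Qed.

Let h_lip u v : u \in U -> h v <= rho v u + h u.
Proof.
move=> uU; apply: le_trans (h_min v (piP uU)) _; exact: rhotri.
Qed.

(* Junk at h v = 0, where the edge above v is always cut. *)
Definition cost v : nat :=
  if len v == 0 then 0%N else (Num.truncn (2 * N%:R * len v / h v)).+1.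

Lemma cost_ge v : h v != 0 -> 2 * N%:R * len v <= (cost v)%:R * h v.
Proof.
move=> hv; have hv0 : 0 < h v by rewrite lt_def hv rho_ge0.
rewrite /cost; case: eqP => [->|_]; first by rewrite mulr0 mul0r.
rewrite -ler_pdivrMr //; apply/ltW/truncnS_gt.
Qed.

(** By [N_big], N len / h is at least 1 on an edge of positive length, so rounding 2 N len / h up
    gives at most 3 N len / h. *)
Lemma cost_le v : h v != 0 -> (cost v)%:R * h v <= 3 * N%:R * len v.
Proof.
move=> hv; have hv0 : 0 < h v by rewrite lt_def hv rho_ge0.
rewrite /cost; case: eqP => [->|/eqP lv]; first by rewrite mulr0 mul0r.
have lv0 : 0 < len v by rewrite lt_def lv rho_ge0.
rewrite -addn1 natrD mulrDl mul1r.
have -> : 3 * N%:R * len v = 2 * N%:R * len v + N%:R * len v by ring.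
apply: lerD; last exact: N_big.
rewrite -ler_pdivlMr // truncn_le // divr_ge0 ?mulr_ge0 ?ler0n //; exact: ltW.
Qed.

(* The sum of len / h over the edges from v to the root of p, in units of
   1 / (2 N) and rounded up on each edge. *)
Definition depth v : nat := \sum_(a in U :\: P) cost a * fconnect p v a.

Lemma depth_parent v : v \in U :\: P -> p v <> v ->
  depth v = (depth (p v) + cost v)%N.
Proof.
move=> vW pv; case: treeW => [[f fP] _].
rewrite /depth (bigD1 v) //= [in RHS](bigD1 v) //= connect0 muln1.
rewrite (tree_parentF fP) // muln0 add0n addnC; congr addn.
apply: eq_bigr => a /andP[_ av]; rewrite (fconnectE p v) [v == a]eq_sym.
by rewrite (negbTE av).
Qed.

(* The tree is cut where the depth crosses a point of N Z - t. *)
Definition cut (t : 'I_N) v : bool :=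
  [|| p v == v, h v == 0 |
      ((depth v + t) %/ N != (depth (p v) + t) %/ N)%N].

Definition attach (t : 'I_N) v : X :=
  if v \in P then q v else if cut t v then pi v else p v.

Lemma attachP t v : v \in P -> attach t v = q v.
Proof. by rewrite /attach => ->. Qed.

Lemma attach_cut t v : v \in U :\: P -> cut t v -> attach t v = pi v.
Proof. by rewrite /attach inE => /andP[/negbTE-> _] ->. Qed.

Lemma attach_uncut t v : v \in U :\: P -> ~~ cut t v -> attach t v = p v.
Proof. by rewrite /attach inE => /andP[/negbTE-> _] /negbTE->. Qed.

Lemma attach_tree t : is_tree U (attach t).
Proof.
case: treeP => [[fp fpP] rP]; case: (treeW) => [[f fW] rW].
(* Ranks below B are kept for P, and the other points get B + f: an uncut edge lowers f, and a cut
   one lands in P. *)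
pose B := (\sum_(b in P) fp b).+1.
have fpB v : v \in P -> (fp v < B)%N.
  by move=> vP; rewrite ltnS (bigD1 v) //= leq_addr.
have WP v : v \in U -> v \notin P -> v \in U :\: P by rewrite !inE => -> ->.
split; first exists (fun v => if v \in P then fp v else (B + f v)%N).
  move=> v vU; have [vP|vP] := boolP (v \in P).
    by rewrite attachP //; have [qP ?] := fpP _ vP; rewrite qP (fintype.subsetP PU).
  have vW := WP _ vU vP; have [cv|cv] := boolP (cut t v).
    rewrite attach_cut // piP // (fintype.subsetP PU) ?piP //; split=> // _.
    by apply: leq_trans (leq_addr _ _); rewrite fpB // piP.
  rewrite attach_uncut //; have [+ lt_p] := fW _ vW.
  rewrite inE => /andP[/negbTE -> ->]; split=> // /lt_p.
  by rewrite ltn_add2l.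
have rootP v : v \in U -> attach t v = v -> v \in P.
  move=> vU; apply: contraPT => vP; have vW := WP _ vU vP.
  have [cv|cv] := boolP (cut t v).
    by rewrite attach_cut // => E; move: vP; rewrite -E piP.
  by rewrite attach_uncut // => E; move: cv; rewrite /cut E eqxx.
move=> u v uU vU Eu Ev; have [uP vP] := (rootP _ uU Eu, rootP _ vU Ev).
by apply: rP => //; [rewrite -[RHS]Eu|rewrite -[RHS]Ev]; rewrite attachP.
Qed.

Let delta t := tree_dist U (attach t) rho.

Let pdelta t : pseudometric (delta t).
Proof. exact: tree_dist_pseudometric. Qed.
Let deltaC t x y : delta t x y = delta t y x.
Proof. by case: (pdelta t). Qed.
Let deltatri t x y z : delta t x z <= delta t x y + delta t y z.
Proof. by case: (pdelta t). Qed.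

Let delta_edge t v : v \in U -> delta t v (attach t v) <= rho v (attach t v).
Proof. exact/tree_dist_edge/attach_tree. Qed.

(** The edges of P survive in every attached tree, so its metric on P is at most the path metric,
    which [geodP] bounds. *)
Lemma attach_dist_in t a b : a \in P -> b \in P -> delta t a b <= rho a b.
Proof.
move=> aP bP; apply: le_trans (geodP aP bP); rewrite -[leRHS]mul1r.
case: treeP => [[f fP] rP]; apply: (le_tree_dist fP) => //.
by move=> v vP; rewrite mul1r -(attachP t) // delta_edge // (fintype.subsetP PU).
Qed.

(* r is the root of the piece of v and L the length of the chain from v to r.
   The sum of len / h over the chain is G / (2 N), with G the difference of the
   depths, and h grows by a factor of at most 1 + len / h along each edge, whence
   L <= h v * G / (2 N - G). *)
Lemma uncut_chain t v : v \in U :\: P -> exists r L,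
  [/\ r \in U :\: P, cut t r, delta t v r <= L /\ rho v r <= L,
      (depth r <= depth v)%N /\ ((depth v + t) %/ N = (depth r + t) %/ N)%N &
      L * (2 * N%:R - (depth v - depth r)%:R) <= h v * (depth v - depth r)%:R].
Proof.
case: (treeW) => [[f fW] rW].
move: {2}(f v).+1 (ltnSn (f v)) => n; elim: n v => // n IH v le_n vW.
have [cv|cv] := boolP (cut t v).
  exists v, 0; split=> //; last by rewrite subnn mul0r mulr0.
  by rewrite rho0; case: (pdelta t) => ->.
move: (cv); rewrite /cut !negb_or negbK => /and3P[/eqP pv hv /eqP dv].
have [pW lt_p] := fW _ vW.
have [|r [L [rW' cr [dL rL] [le_r q_r] bound]]] := IH (p v) _ pW.
  by rewrite ltnS in le_n; apply: leq_trans le_n; apply: lt_p.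
have vU : v \in U by move: vW; rewrite inE => /andP[].
have pU : p v \in U by move: pW; rewrite inE => /andP[].
have dE := depth_parent vW pv.
exists r, (len v + L); split=> //.
- have := delta_edge t vU; rewrite attach_uncut // => le1.
  have := deltatri t v (p v) r; have := rhotri v (p v) r.
  by rewrite -/(len v) in le1 *; lra.
- by rewrite dv dE (leq_trans le_r) ?leq_addr.
have -> : (depth v - depth r)%:R = (depth (p v) - depth r)%:R + (cost v)%:R :> R.
  by rewrite dE addnC -addnBA // natrD addrC.
have := h_lip (p v) vU; rewrite rhoC -/(len v).
move: bound (cost_ge hv); move: (depth _ - _)%N (cost v) => G c.
have : 0 <= len v by exact: rho_ge0.
have : 0 <= L by exact: le_trans rL.
have : 0 <= G%:R :> R by []. have : 0 <= c%:R :> R by [].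
move: G%:R c%:R N%:R (len v) (h v) (h (p v)) => {}G {}c K l hv' hp.
move=> c0 G0 L0 l0 b1 b2 b3.
(* Expand (l + L)(2 K - G - c): [b2] bounds 2 K l by c hv', [b1] bounds L (2 K - G) by hp G, [m3]
   replaces hp by l + hv', and the terms - c l and - c L are dropped. *)
have := mulr_ge0 G0 (_ : 0 <= l + hv' - hp).
have := mulr_ge0 c0 l0. have := mulr_ge0 c0 L0.
move=> m1 m2 m3; have {}m3 : 0 <= G * (l + hv' - hp) by apply: m3; lra.
nra.
Qed.

(** The depths of v and of the root r of its piece differ by at most N, so the bound of
    [uncut_chain] gives L <= h v. Then h r <= 2 h v, and going from v to r to [pi r] costs at most 3
    h v. *)
Lemma attach_near t v : v \in U -> exists c,
  [/\ c \in P, delta t v c <= 3 * h v & rho v c <= 3 * h v].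
Proof.
move=> vU; have [vP|vP] := boolP (v \in P).
  have h3 : 0 <= 3 * h v by rewrite mulr_ge0 // rho_ge0.
  by exists v; split=> //; [case: (pdelta t) => ->|rewrite rho0].
have vW : v \in U :\: P by rewrite inE vP.
have [r [L [rW cr [dL rL] [le_r q_r] bound]]] := uncut_chain t vW.
have rU : r \in U by move: rW; rewrite inE => /andP[].
have Lh : L <= h v.
  have lt_N : (depth v - depth r <= N)%N.
    by apply/ltnW; rewrite -(subnDr t); apply: divn_eq_ltn_sub;
      rewrite ?leq_add2r.
  have N0 : 0 < N%:R :> R by rewrite ltr0n.
  have L0 : 0 <= L by exact: le_trans rL.
  rewrite -(ler_pM2r N0); move: lt_N; rewrite -(ler_nat R).
  have := rho_ge0 v (pi v); rewrite -/(h v).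
  by move: (_ - _)%N%:R bound => G; nra.
have h_r : h r <= 2 * h v by have := h_lip r vU; rewrite rhoC; lra.
exists (pi r); split; first exact: piP.
- have := delta_edge t rU; rewrite attach_cut // -/(h r).
  have := deltatri t v r (pi r); lra.
- have := rhotri v r (pi r); rewrite -/(h r); lra.
Qed.

(** With h u <= rho u b, going through the point c near u costs 3 rho u b to reach c and at most 4
    rho u b from c to b. *)
Lemma attach_dist_out t u b : u \in U -> b \in P -> delta t u b <= 7 * rho u b.
Proof.
move=> uU bP; have [c [cP dc rc]] := attach_near t uU.
have := attach_dist_in t cP bP; have := h_min u bP; have := rhotri c u b.
have := deltatri t u c b; rewrite (rhoC c u); lra.
Qed.

Lemma attach_edge t a : a \in U :\: P -> delta t a (p a) <=
  19 * len a + (cut t a && (h a != 0))%:R * (12 * h a).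
Proof.
move=> aW; have aU : a \in U by move: aW; rewrite inE => /andP[].
have pU : p a \in U.
  by case: treeW => [[f fW] _]; have [] := fW _ aW; rewrite inE => /andP[].
have l0 : 0 <= len a by exact: rho_ge0.
have h0 : 0 <= h a by exact: rho_ge0.
have [ca|ca] /= := boolP (cut t a); last first.
  by have := delta_edge t aU; rewrite attach_uncut // -/(len a); lra.
have -> : (h a != 0)%:R * (12 * h a) = 12 * h a.
  by have [->|_] := eqVneq (h a) 0; rewrite ?mul1r // !mulr0.
(* The route a, c, c', p a through points of P near a and near p a costs at most 6 h a + len a + 6 h
   (p a), hence at most 7 len a + 12 h a. *)
have [c [cP dc rc]] := attach_near t aU.
have [c' [cP' dc' rc']] := attach_near t pU.
have hp := h_lip (p a) aU; rewrite (rhoC (p a) a) -/(len a) in hp.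
have := attach_dist_in t cP cP'.
have := deltatri t a c (p a); have := deltatri t c c' (p a).
have := rhotri c a c'; have := rhotri a (p a) c'.
rewrite (deltaC t c' (p a)) (rhoC c a) -/(len a); lra.
Qed.

(** At most [cost a] of the N shifts cut the edge above a through its depth, and [cost a] times h a
    is at most 3 N len a; so 55 = 19 + 12 * 3. *)
Lemma attach_edge_mean a : a \in U :\: P ->
  \sum_t delta t a (p a) <= 55 * N%:R * len a.
Proof.
move=> aW; have [pa|/eqP pa] := eqVneq (p a) a.
  rewrite big1 => [|t _]; first by rewrite !mulr_ge0 // rho_ge0.
  by rewrite pa; case: (pdelta t).
apply: le_trans (ler_sum _ (fun t _ => attach_edge t aW)) _.
rewrite big_split /= sumr_const card_ord -mulr_suml -natr_sum -mulr_natl.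
suff : (\sum_(t < N) (cut t a && (h a != 0%R)))%N%:R * (12 * h a) <=
    36 * N%:R * len a by lra.
have [ha|ha] := eqVneq (h a) 0.
  by rewrite ha !mulr0 !mulr_ge0 // rho_ge0.
have le_c : (\sum_(t < N) (cut t a && true) <= cost a)%N.
  apply: leq_trans (card_divn_shift_neq (depth (p a)) (cost a) N_gt0).
  apply: leq_sum => t _; rewrite andbT /cut.
  by rewrite (negbTE ha) (introF eqP pa) /= (depth_parent aW pa).
have := cost_le ha; have ha0 : 0 <= h a by exact: rho_ge0.
move: le_c; rewrite -(ler_nat R) => /(ler_wpM2r ha0); lra.
Qed.

End Attach.

(** * Random trees for layered spaces *)

Section Layers.
Variables (R : realType) (X : finType) (lay : X -> nat) (m : nat).
Implicit Types (d : X -> X -> R) (U : {set X}).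

Definition adjacent_layers (u v : X) : bool :=
  (lay u <= (lay v).+1)%N && (lay v <= (lay u).+1)%N.

Section Geodesic.
Variables (d : X -> X -> R) (U : {set X}) (z : nat -> X).
Hypothesis pd : pseudometric d.
Hypothesis layU : forall u, u \in U -> (lay u <= m)%N.
Hypothesis zP : forall i, (i <= m)%N -> z i \in U /\ lay (z i) = i.

Let d0 x : d x x = 0. Proof. by case: pd. Qed.
Let dC x y : d x y = d y x. Proof. by case: pd. Qed.
Let dtri x y t : d x t <= d x y + d y t. Proof. by case: pd. Qed.
Let d_ge0 x y : 0 <= d x y. Proof. exact: pseudometric_ge0. Qed.

Definition best (F : X -> R) i u : X :=
  [arg min_(w < z i | (w \in U) && (lay w == i)) (F w + d w u)%R]%O.

(* pot i u is the least length of a walk to u that visits each of the layers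
   0, ..., i - 1 once, in this order. *)
Fixpoint pot i u : R :=
  if i is j.+1 then pot j (best (pot j) j u) + d (best (pot j) j u) u else 0.

Definition potential u : R := pot (lay u) u.
Definition previous u : X := if lay u is i.+1 then best (pot i) i u else u.

Lemma bestP F i u : (i <= m)%N ->
  [/\ best F i u \in U, lay (best F i u) = i &
      forall y, y \in U -> lay y = i ->
        F (best F i u) + d (best F i u) u <= F y + d y u].
Proof.
move=> /zP[zU zi]; rewrite /best.
case: arg_minP => [|w /andP[wU /eqP wi] wmin] /=; first by rewrite zU zi /=.
by split=> // y yU yi; apply: wmin; rewrite yU yi /=.
Qed.

Lemma previousP u i : u \in U -> lay u = i.+1 ->
  [/\ previous u \in U, lay (previous u) = i,
      potential u = potential (previous u) + d (previous u) u &
      forall y, y \in U -> lay y = i -> potential u <= potential y + d y u].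
Proof.
move=> uU ui; have /ltnW im : (i < m)%N by rewrite -ui layU.
have [bU bi bmin] := bestP (pot i) u im.
rewrite /previous /potential ui bi; split=> // y yU yi.
by rewrite yi; apply: bmin.
Qed.

(** The best predecessor of u is also a candidate for v. *)
Lemma potential_same u v : u \in U -> v \in U -> lay u = lay v ->
  potential v <= potential u + d u v.
Proof.
move=> uU vU uv; case ui: (lay u) => [|i].
  by rewrite /potential -uv ui /= add0r.
have [wU wi -> _] := previousP uU ui.
have [_ _ _ /(_ _ wU wi)] := previousP vU (etrans (esym uv) ui).
by have := dtri (previous u) u v; lra.
Qed.

Lemma potential_lip u v : u \in U -> v \in U -> adjacent_layers u v ->
  `|potential u - potential v| <= d u v.
Proof.
(* If x is one layer above y, then y is a candidate predecessor of x; if one layer below, x is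
   compared with the predecessor of y, which lies in the layer of x. *)
have half x y : x \in U -> y \in U -> adjacent_layers x y ->
    potential x <= potential y + d y x.
  move=> xU yU /andP[]; rewrite leq_eqVlt => /orP[/eqP xy _|].
    by have [_ _ _] := previousP xU xy; apply.
  rewrite ltnS => xy; rewrite leq_eqVlt => /orP[/eqP yx|]; last first.
    by rewrite ltnS => yx; apply: potential_same => //; apply/eqP;
      rewrite eqn_leq yx xy.
  have [wU wi -> _] := previousP yU yx.
  have := potential_same wU xU wi; have := dtri (previous y) y x; lra.
move=> uU vU uv; rewrite ler_norml.
have := half _ _ uU vU uv; have := half _ _ vU uU; rewrite /adjacent_layers andbC.
by move=> /(_ uv); rewrite (dC v u); lra.
Qed.

Definition path_point i : X := iter (m - i) previous (z m).

Lemma path_pointP i : (i <= m)%N ->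
  path_point i \in U /\ lay (path_point i) = i.
Proof.
move=> im; suff /(_ _ (leq_subr i m)) : forall n, (n <= m)%N ->
    iter n previous (z m) \in U /\ lay (iter n previous (z m)) = (m - n)%N.
  by rewrite (subKn im).
elim=> [_|n IH nm]; first by rewrite subn0; apply: zP.
have [xU xi] := IH (ltnW nm).
by have [] := previousP xU (_ : lay _ = (m - n.+1).+1); first by rewrite xi subnSK.
Qed.

Lemma previous_path_point i : (i < m)%N -> previous (path_point i.+1) = path_point i.
Proof. by move=> im; rewrite /path_point -[(m - i)%N]subnSK. Qed.

Definition geodesic : {set X} := [set a in U | a == path_point (lay a)].

Lemma geodesic_inj a b : a \in geodesic -> b \in geodesic -> lay a = lay b ->
  a = b.
Proof. by rewrite !inE => /andP[_ /eqP aE] /andP[_ /eqP bE] ab; rewrite aE bE ab. Qed.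

Lemma geodesic_previous a i : a \in geodesic -> lay a = i.+1 ->
  previous a \in geodesic.
Proof.
rewrite !inE => /andP[aU /eqP aE] ai.
have [pU -> _ _] := previousP aU ai; rewrite pU aE ai previous_path_point ?eqxx //.
by rewrite -ai layU.
Qed.

Lemma card_geodesic i : (i <= m)%N ->
  #|[set u in geodesic | lay u == i]| = 1%N.
Proof.
move=> im; have [xU xi] := path_pointP im.
rewrite -(cards1 (path_point i)); apply: eq_card => u; rewrite !inE.
apply/andP/eqP => [[/andP[_ /eqP {2}-> /eqP->]]//|->].
by rewrite xU xi !eqxx.
Qed.

Lemma geodesic_tree : is_tree geodesic previous.
Proof.
have prev0 u : lay u = 0%N -> previous u = u by rewrite /previous => ->.
split; first exists lay.
  move=> v vP; have vU : v \in U by move: vP; rewrite inE => /andP[].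
  case vi: (lay v) => [|i]; first by rewrite prev0.
  by have [_ -> _ _] := previousP vU vi; rewrite (geodesic_previous vP vi).
have root v : v \in geodesic -> previous v = v -> lay v = 0%N.
  rewrite inE => /andP[vU _] pv; case vi: (lay v) => [//|i].
  have [_ + _ _] := previousP vU vi; rewrite pv vi => /eqP.
  by rewrite eqn_leq ltnn.
by move=> u v uP vP pu pv; apply: geodesic_inj => //; rewrite !root.
Qed.

(** Adding the potential difference makes the shortest layered path a geodesic, since the potential
    grows along it by exactly the length of each step. Distances between adjacent layers do not
    change, because the potential is 1-Lipschitz there. *)
Definition stretch u v : R := Num.max (d u v) `|potential u - potential v|.

Lemma stretch_pseudometric : pseudometric stretch.
Proof.
split=> [x|x y|x y t]; rewrite /stretch.
- by rewrite d0 subrr normr0 maxxx.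
- by rewrite dC distrC.
rewrite ge_max; apply/andP; split.
  by apply: le_trans (dtri x y t) _; apply: lerD; rewrite le_max lexx.
apply: le_trans (ler_distD (potential y) _ _) _.
by apply: lerD; rewrite le_max lexx orbT.
Qed.

Lemma le_stretch u v : d u v <= stretch u v.
Proof. by rewrite le_max lexx. Qed.

Lemma stretch_adjacent u v : u \in U -> v \in U -> adjacent_layers u v ->
  stretch u v = d u v.
Proof. by move=> uU vU uv; apply/max_idPl; apply: potential_lip. Qed.

(** The steps of the path telescope to the difference of potentials, which [stretch] dominates. *)
Lemma geodesic_dist a b : a \in geodesic -> b \in geodesic ->
  tree_dist geodesic previous stretch a b <= stretch a b.
Proof.
have [_ tC ttri] := tree_dist_pseudometric geodesic previous stretch_pseudometric.
move=> aP bP.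
have [t0 _ _] := tree_dist_pseudometric geodesic previous stretch_pseudometric.
apply: (@le_trans _ _ `|potential a - potential b|); last first.
  by rewrite le_max lexx orbT.
wlog ab : a b aP bP / (lay a <= lay b)%N => [H|].
  by have [/H->//|/ltnW/H] := leqP (lay a) (lay b); rewrite tC distrC => ->.
rewrite distrC; apply: le_trans (ler_norm _).
move bn: (lay b - lay a)%N => n; elim: n b bP ab bn => [|n IH] b bP ab bn.
  have <- : a = b by apply: geodesic_inj => //; lia.
  by rewrite t0 subrr.
have bU : b \in U by move: bP; rewrite inE => /andP[].
have bi : lay b = (lay b).-1.+1 by lia.
have [_ pi pot_b _] := previousP bU bi.
have pP := geodesic_previous bP bi.
apply: le_trans (ttri _ (previous b) _) _.
have /IH : (lay a <= lay (previous b))%N by lia.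
move=> /(_ pP); rewrite pi => /(_ _) IH'.
have {}IH' := IH' ltac:(lia).
have := tree_dist_edge stretch_pseudometric geodesic_tree bP.
have -> : stretch b (previous b) = d (previous b) b.
  rewrite stretch_adjacent ?(dC b) //; last by rewrite /adjacent_layers pi; lia.
  by move: pP; rewrite inE => /andP[].
rewrite (tC (previous b) b) pot_b; lra.
Qed.

End Geodesic.

Lemma tree_dist_le U p (d rho : X -> X -> R) u v :
  (forall x y, d x y <= rho x y) -> tree_dist U p d u v <= tree_dist U p rho u v.
Proof.
by move=> le_d; apply: ler_sum => a _; apply: ler_wpM2r.
Qed.

(** The random tree is uniform on [I]. It dominates d because its edges have their d-length. The
    mean is bounded only for adjacent layers, where the stretched metrics of the induction agree
    with d. *)
Lemma layered_trees k d U : pseudometric d ->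
  (forall u, u \in U -> (lay u <= m)%N) ->
  (forall i, (i <= m)%N -> #|[set u in U | lay u == i]| = k) ->
  exists (I : finType) (p : I -> X -> X),
    [/\ (0 < #|I|)%N, forall i, is_tree U (p i) &
        forall u v, u \in U -> v \in U -> adjacent_layers u v ->
          \sum_i tree_dist U (p i) d u v <= 55 ^+ k * #|I|%:R * d u v].
Proof.
elim: k d U => [|k IH] d U pd layU cardU.
  have U0 u : u \notin U.
    apply/negP => uU; have /cards0_eq/setP/(_ u) := cardU _ (layU _ uU).
    by rewrite !inE uU eqxx.
  exists unit, (fun _ => id); split; rewrite ?card_unit //.
    by move=> _; split; [exists (fun=> 0%N) => v|move=> u v];
      rewrite (negbTE (U0 _)).
  by move=> u v; rewrite (negbTE (U0 _)).
have /choice[z zP] : forall i, exists z : X, (i <= m)%N -> z \in U /\ lay z = i.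
  move=> i; have [im|im] := leqP i m; last first.
    have [z0 _] : exists z, z \in [set u in U | lay u == 0%N].
      by apply/set0Pn; rewrite -card_gt0 cardU.
    by exists z0.
  have [z0] : exists z, z \in [set u in U | lay u == i].
    by apply/set0Pn; rewrite -card_gt0 cardU.
  by rewrite inE => /andP[? /eqP ?]; exists z0.
set rho := stretch d U z; set P := geodesic d U z; set q := previous d U z.
have prho : pseudometric rho by apply: stretch_pseudometric.
have PU : P \subset U by apply/fintype.subsetP => a; rewrite inE => /andP[].
have treeP : is_tree P q by apply: geodesic_tree.
have [||J [p [J0 treeW distW]]] := IH rho (U :\: P) prho.
- by move=> u; rewrite inE => /andP[_ /layU].
- move=> i im; apply/eqP; rewrite -eqSS -(cardU i im) -add1n.
  rewrite -(card_geodesic d layU zP im) -/P -(cardsID P [set u in U | _]).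
  apply/eqP; congr addn; apply: eq_card => u.
    by rewrite finset.in_setI !finset.in_set; case: (u \in U); rewrite //= andbC.
  by rewrite finset.in_setD !finset.in_set andbA.
pose b0 := path_point d U z 0.
have b0P : b0 \in P.
  by have [bU bi] := path_pointP d layU zP (leq0n m); rewrite inE bU bi /=.
pose pi v := [arg min_(b < b0 | b \in P) rho v b]%O.
have piP v : pi v \in P by rewrite /pi; case: arg_minP.
have pi_min v b : b \in P -> rho v (pi v) <= rho v b.
  by move=> bP; rewrite /pi; case: arg_minP => // c _; apply.
(* N exceeds every ratio of the distance from a to P to a distance [rho a b]; the successor makes it
   positive. *)
pose N := (\sum_a \sum_b Num.bound (rho a (pi a) / rho a b)%R).+1.
have N_big a b : 0 < rho a b -> rho a (pi a) <= N%:R * rho a b.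
  move=> ab0; rewrite -ler_pdivrMr //; apply/ltW.
  apply: lt_le_trans (archi_boundP _) _.
    by rewrite divr_ge0 // ?pseudometric_ge0 // ltW.
  by rewrite ler_nat /N (bigD1 a) //= (bigD1 b) //= -addnA -addnS leq_addr.
pose p' (it : J * 'I_N) := attach rho U P q (p it.1) pi it.2.
exists (J * 'I_N)%type, p'; split.
- by rewrite card_prod card_ord muln_gt0 J0.
- by move=> [i t]; apply: attach_tree => //= v _.
move=> u v uU vU uv.
rewrite -(stretch_adjacent pd layU zP uU vU uv) -/rho.
have rho0 := pseudometric_ge0 u v prho.
(* The trees are analysed with the longer edge lengths rho; returning to d only shrinks them. *)
apply: (@le_trans _ _ (\sum_it tree_dist U (p' it) rho u v)).
  by apply: ler_sum => it _; apply: tree_dist_le; apply: le_stretch.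
rewrite -(pair_bigA _ (fun i t =>
  tree_dist U (attach rho U P q (p i) pi t) rho u v)) /= card_prod card_ord.
have geodP a b : a \in P -> b \in P -> tree_dist P q rho a b <= rho a b.
  by apply: geodesic_dist.
pose s i x y := \sum_(t < N) tree_dist U (attach rho U P q (p i) pi t) rho x y.
have ps i : pseudometric (s i).
  by apply: pseudometric_sum => t; apply: tree_dist_pseudometric.
have sC i x y : s i x y = s i y x by case: (ps i).
rewrite natrM exprS.
have ge1 : 1 <= 55 ^+ k :> R by rewrite exprn_ege1 // ler1n.
have N0 : 0 <= N%:R :> R by [].
have J1 : 0 <= #|J|%:R :> R by [].
(* With an endpoint on P every single tree has stretch at most 7, without averaging. *)
have out x y : x \in U -> y \in P ->
    \sum_i s i x y <= 55 * 55 ^+ k * (#|J|%:R * N%:R) * rho x y.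
  move=> xU yP; have rxy := pseudometric_ge0 x y prho.
  apply: (@le_trans _ _ (\sum_(i : J) \sum_(t < N) 7 * rho x y)).
    apply: ler_sum => i _; apply: ler_sum => t _.
    by apply: (attach_dist_out prho PU treeP).
  rewrite !sumr_const card_ord -mulrnA -[leLHS]mulr_natl natrM.
  have M0 : 0 <= #|J|%:R * N%:R * rho x y by rewrite !mulr_ge0.
  have := mulr_ge0 M0 (_ : 0 <= 55 ^+ k - 1); rewrite subr_ge0 => /(_ ge1).
  lra.
have [uP|uP] := boolP (u \in P).
  have := out v u vU uP; have [_ -> _] := prho.
  by rewrite (eq_bigr _ (fun i _ => sC i v u)).
have [vP|vP] := boolP (v \in P); first exact: out.
have uW : u \in U :\: P by rewrite inE uP.
have vW : v \in U :\: P by rewrite inE vP.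
(* Off P, [s i] is a pseudometric that is at most 55 N times the edge length on each edge of the
   tree [p i], hence at most 55 N times its tree metric; the induction hypothesis then averages over
   i. *)
apply: (@le_trans _ _ (\sum_i 55 * N%:R * tree_dist (U :\: P) (p i) rho u v)).
  apply: ler_sum => i _; case: (treeW i) => [[f fW] rW].
  apply: (le_tree_dist fW rW (ps i)) => // a aW.
  by apply: (attach_edge_mean prho PU treeP).
rewrite -mulr_sumr.
have := distW u v uW vW uv; move/(ler_wpM2l (_ : 0 <= 55 * N%:R)).
move=> /(_ (mulr_ge0 (ler0n _ _) N0)); lra.
Qed.

End Layers.

(** * Steiner trees and tours *)

Section Walks.
Variable R : realType.

Lemma walk_length_map (T X : Type) (val : X -> T) (d : T -> T -> R) x s :
  walk_length d (val x) (map val s) =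
  walk_length (fun u v => d (val u) (val v)) x s.
Proof. by elim: s x => //= y s IH x; rewrite IH. Qed.

Lemma walk_length_rcons (T : Type) (d : T -> T -> R) x s y :
  walk_length d x (rcons s y) = walk_length d x s + d (last x s) y.
Proof. by elim: s x => /= [|z s IH] x; rewrite ?addr0 ?add0r // IH addrA. Qed.

Lemma le_walk_length (T : Type) (d d' : T -> T -> R) (K : R) x s :
  (forall u v, d u v <= K * d' u v) ->
  walk_length d x s <= K * walk_length d' x s.
Proof.
by move=> le_d; elim: s x => /= [|y s IH] x; rewrite ?mulr0 // mulrDr lerD.
Qed.

Lemma walk_length_sum (T : Type) (J : finType) (c : J -> R)
    (d : J -> T -> T -> R) x s :
  \sum_j c j * walk_length (d j) x s =
  walk_length (fun u v => \sum_j c j * d j u v) x s.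
Proof.
elim: s x => /= [|y s IH] x; first by apply: big1 => j _; rewrite mulr0.
by rewrite -IH -big_split; apply: eq_bigr => j _; rewrite mulrDr.
Qed.

Lemma walk_detour (T : eqType) (d : T -> T -> R) x s c l : c \in x :: s ->
  exists s', [/\ last x s' = last x s, {subset l :: x :: s <= x :: s'} &
    walk_length d x s' = walk_length d x s + d c l + d l c].
Proof.
elim: s x => [|y s IH] x.
  rewrite mem_seq1 => /eqP->; exists [:: l; x]; split=> //=; last by ring.
  by move=> u; rewrite !inE; case: (u == x) (u == l) => [] [].
rewrite inE => /orP[/eqP->|/IH[s' [ls sub_s len_s]]].
  exists (l :: x :: y :: s); split=> //=; last by ring.
  by move=> u; rewrite !inE; case: (u == x) (u == l) => [] [].
exists (y :: s'); split=> //=; last by rewrite len_s; ring.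
move=> u; rewrite !inE => /or3P[/eqP->|->//|uys]; apply/orP; right;
  rewrite -in_cons; apply: sub_s; rewrite !inE ?eqxx //.
by rewrite uys orbT.
Qed.

End Walks.

Definition separates (T : finType) (S : pred T) (Z : {set T}) : bool :=
  [exists x in Z, exists y in Z, S x != S y].

Lemma separatesP (T : finType) (S : pred T) (Z : {set T}) :
  reflect (exists x y, [/\ x \in Z, y \in Z & S x != S y]) (separates S Z).
Proof.
apply: (iffP existsP) => [[x /andP[xZ /existsP[y /andP[yZ xy]]]]|].
  by exists x, y.
move=> [x [y [xZ yZ xy]]]; exists x; rewrite xZ; apply/existsP.
by exists y; rewrite yZ.
Qed.

(** If S splits Z, some point of Z lies on the other side from x, and the walk must cross to reach
    it. *)
Lemma separates_walk (R : realType) (T : finType) (S : pred T) (Z : {set T}) x s :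
  {subset Z <= x :: s} ->
  (separates S Z)%:R <= walk_length (fun u v => (S u != S v)%:R) x s :> R.
Proof.
have visit t y : y \in x :: t ->
    (S x != S y)%:R <= walk_length (fun u v => (S u != S v)%:R) x t :> R.
  elim: t x => [|z t IH] w /=; first by rewrite mem_seq1 => /eqP->; rewrite eqxx.
  have ge0 u r : 0 <= walk_length (fun u v => (S u != S v)%:R) u r :> R.
    by elim: r u => //= v r IHr u; rewrite addr_ge0.
  rewrite inE => /orP[/eqP->|/IH]; first by rewrite eqxx addr_ge0.
  move=> le_z; apply: (@le_trans _ _ ((S w != S z)%:R + (S z != S y)%:R)).
    by rewrite -natrD ler_nat; case: (S w) (S z) (S y) => [] [] [].
  by rewrite lerD2l.
move=> Zs; have [/separatesP[u [v [/Zs uZ /Zs vZ uv]]]|_] := boolP (separates S Z).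
  have : (S x != S u) || (S x != S v).
    by move: uv; case: (S x) (S u) (S v) => [] [] [].
  by case/orP=> Sx; [have := visit _ _ uZ|have := visit _ _ vZ]; rewrite Sx.
apply: le_trans (visit s x (mem_head _ _)); exact: ler0n.
Qed.

Section Steiner.
Variables (R : realType) (X : finType) (U : {set X}) (p : X -> X).
Variable d : X -> X -> R.
Hypothesis pd : pseudometric d.
Hypothesis treeU : is_tree U p.

(** The length of the smallest subtree that contains Z: an edge belongs to it exactly when it
    separates two points of Z. *)
Definition steiner (Z : {set X}) : R :=
  \sum_(a in U) d a (p a) * (separates (fun u => fconnect p u a) Z)%:R.

Let d_ge0 x y : 0 <= d x y. Proof. exact: pseudometric_ge0. Qed.
Let dC x y : d x y = d y x. Proof. by case: pd. Qed.

Lemma steiner_ge0 Z : 0 <= steiner Z.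
Proof. by apply: sumr_ge0 => a _; rewrite mulr_ge0. Qed.

(* Depth-first traversal: remove a deepest point l of Z, replace it by its
   parent, and add the detour to l. *)
Lemma closed_walk_steiner (Z : {set X}) z : Z \subset U -> z \in Z ->
  exists s, [/\ last z s = z, {subset Z <= z :: s} &
                walk_length d z s <= 2 * steiner Z].
Proof.
case: (treeU) => [[f fP] rU].
move: {2}(\sum_(u in Z) f u).+1 (ltnSn (\sum_(u in Z) f u)%N) => n.
elim: n Z z => // n IH Z z le_n ZU zZ.
have [l lZ l_max] := @arg_maxnP _ z (mem Z) f zZ.
have {}lZ : l \in Z by [].
have lU := fintype.subsetP ZU _ lZ.
have [Z1|[w]] := set_0Vmem (Z :\ l).
  exists [::]; split=> //=; last by rewrite mulr_ge0 // steiner_ge0.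
  have Zl : Z = [set l] by rewrite -(finset.setD1K lZ) Z1 finset.setU0.
  by move: zZ; rewrite Zl => /set1P-> u /set1P->; rewrite mem_head.
rewrite finset.in_setD1 => /andP[/eqP wl wZ]; have wU := fintype.subsetP ZU _ wZ.
have anc u : u \in Z -> u <> l -> ~~ fconnect p u l.
  move=> uZ ul; apply/negP => ul'.
  have := tree_ancestor_lt fP (fintype.subsetP ZU _ uZ) (nesym ul) ul'.
  by rewrite ltnNge; have /= -> := l_max _ uZ.
have pl : p l <> l.
  by move=> pl; have := anc _ wZ wl; rewrite (tree_root_ancestor fP).
have [pU lt_p] := fP _ lU.
pose Z' := p l |: (Z :\ l).
(* As l is deepest, no other point of Z lies below it, so the edge above l separates Z but not Z'.
   Any other edge has l and p l on the same side, so it separates Z if it separates Z'. *)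
have stZ : steiner Z' + d l (p l) <= steiner Z.
  rewrite /steiner (bigD1 l) //= [leRHS](bigD1 l) //=.
  have -> : separates (fun u => fconnect p u l) Z.
    apply/separatesP; exists l, w; split=> //.
    by rewrite connect0 (negbTE (anc _ wZ wl)).
  have -> : separates (fun u => fconnect p u l) Z' = false.
    have F u : u \in Z' -> fconnect p u l = false.
      rewrite !inE => /orP[/eqP->|/andP[/eqP ul uZ]].
        exact: (tree_parentF fP).
      exact/negbTE/anc.
    by apply/separatesP => -[u [v [/F-> /F->]]].
  rewrite mulr0 mulr1 add0r [leRHS]addrC lerD2r; apply: ler_sum => a /andP[_ al].
  apply: ler_wpM2l => //; rewrite ler_nat.
  have [/separatesP[u [v [uZ vZ uv]]]|//] := boolP (separates _ Z').
  have lift y : y \in Z' -> exists2 y', y' \in Z &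
      fconnect p y' a = fconnect p y a.
    rewrite !inE => /orP[/eqP->|/andP[_ yZ]]; last by exists y.
    by exists l => //; rewrite (fconnectE p l) eq_sym (negbTE al).
  have [u' uZ' uE] := lift _ uZ; have [v' vZ' vE] := lift _ vZ.
  by rewrite (introT (separatesP _ _)) //; exists u', v'; rewrite uE vE.
have Z'U : Z' \subset U.
  apply/fintype.subsetP => u; rewrite !inE => /orP[/eqP->//|/andP[_]].
  exact: (fintype.subsetP ZU).
have Z'n : (\sum_(u in Z') f u < n)%N.
  rewrite ltnS in le_n; apply: leq_trans le_n.
  rewrite [X in (_ < X)%N](big_setD1 l) //=.
  apply: (@leq_ltn_trans (f (p l) + \sum_(u in Z :\ l) f u)%N).
    have [pZ|pZ] := boolP (p l \in Z :\ l).
      by rewrite /Z' (finset.setUidPr _) ?finset.sub1set // leq_addl.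
    by rewrite /Z' big_setU1.
  by rewrite ltn_add2r lt_p.
(* If the base point itself was removed, the tour starts at p l and is extended by l at both
   ends. *)
have [zl|/eqP zl] := eqVneq z l.
  have [|s [ls subs lens]] := IH Z' (p l) Z'n Z'U; first by rewrite setU11.
  exists (p l :: rcons s l); split=> /=.
  - by rewrite last_rcons.
  - move=> u uZ; rewrite zl -rcons_cons !(inE, mem_rcons).
    have [//|ul] := eqVneq u l; have := subs u; rewrite !inE ul uZ orbT.
    by move=> /(_ isT) ->; rewrite ?orbT.
  - by rewrite walk_length_rcons ls zl (dC (p l)); lra.
have [|s [ls subs lens]] := IH Z' z Z'n Z'U.
  by rewrite !inE zZ (introF eqP zl) orbT.
have [|s' [ls' subs' lens']] := @walk_detour _ _ d z s (p l) l.
  by apply: subs; rewrite setU11.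
exists s'; split; rewrite ?ls' ?lens' ?(dC (p l)); [by []| |lra].
move=> u uZ; apply: subs'; rewrite inE.
have [//|ul /=] := eqVneq u l; apply: subs.
by rewrite !inE ul uZ orbT.
Qed.

(** A closed tour from x costs twice the Steiner tree, and a final jump to y costs at most once
    more, as every edge between x and y belongs to that tree. *)
Lemma walk_steiner x (C : {set X}) y : x |: (y |: C) \subset U ->
  exists s, [/\ last x s = y, {subset C <= x :: s} &
                walk_length d x s <= 3 * steiner (x |: (y |: C))].
Proof.
set Z := x |: _ => ZU.
have xZ : x \in Z by rewrite setU11.
have yZ : y \in Z by rewrite !inE eqxx orbT.
have [s [ls subs lens]] := closed_walk_steiner ZU xZ.
exists (rcons s y); split; first by rewrite last_rcons.
  move=> u uC; rewrite -rcons_cons mem_rcons inE subs ?orbT //.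
  by rewrite !inE uC !orbT.
rewrite walk_length_rcons ls.
suff : d x y <= steiner Z by lra.
case: (treeU) => [[f fP] rU].
have := @le_tree_dist _ _ U p f fP rU d 1 d pd _ x y.
rewrite mul1r => /(_ _ (fintype.subsetP ZU _ xZ) (fintype.subsetP ZU _ yZ)).
move=> /(_ (fun a _ => _)) le_t; apply: le_trans (le_t _) _.
  by move=> a; rewrite mul1r.
apply: ler_sum => a _; apply: ler_wpM2l => //; rewrite ler_nat.
have [xy|//] := boolP (fconnect p x a != fconnect p y a).
by rewrite (introT (separatesP _ _)) //; exists x, y.
Qed.

End Steiner.

(** * Embedding l_1 into L_1 *)

Section StepFunctions.
Variables (R : realType) (n : nat).

Definition cell (i : 'I_n) : set (measurableTypeR R) :=
  [set` `[(i%:R / n%:R : R), (i.+1%:R / n%:R : R)[].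

(** The factor n offsets the length 1 / n of a cell, so that the L_1 norm is the l_1 norm of c. *)
Definition step_fun (c : 'I_n -> R) (x : measurableTypeR R) : R :=
  \sum_(i < n) c i * n%:R * \1_(cell i) x.

Lemma measurable_cell i : measurable (cell i).
Proof. exact: measurable_itv. Qed.

Lemma lebesgue01_cell i : lebesgue01 R (cell i) = (n%:R^-1)%:E.
Proof.
have n0 : 0 < n%:R :> R by rewrite ltr0n; case: n i => [[]|].
rewrite /lebesgue01 /= /mrestr setIidl; last first.
  move=> x /=; rewrite !in_itv /= => /andP[x1 x2]; apply/andP; split.
    by apply: (@le_trans _ R) x1; rewrite divr_ge0 ?ler0n.
  apply/ltW/(@lt_le_trans _ R _ _ _ x2); rewrite ler_pdivrMr // mul1r ler_nat.
  exact: ltn_ord.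
rewrite lebesgue_measure_itv /= lte_fin ltr_pM2r ?invr_gt0 // ltr_nat ltnSn.
by rewrite -EFinB -mulrBl -natrB // subSnn mul1r.
Qed.

Lemma cell_disjoint i j x : cell i x -> cell j x -> i = j.
Proof.
have n0 : 0 < n%:R :> R by rewrite ltr0n; case: n i {j} => [[]|].
rewrite /cell /= !in_itv /= => /andP[i1 i2] /andP[j1 j2]; apply/val_inj/eqP.
rewrite eqn_leq -ltnS -[(j <= i)%N]ltnS; apply/andP; split.
  by rewrite -(ltr_nat R) -(ltr_pM2r (x := n%:R^-1)) ?invr_gt0 // (le_lt_trans i1).
by rewrite -(ltr_nat R) -(ltr_pM2r (x := n%:R^-1)) ?invr_gt0 // (le_lt_trans j1).
Qed.

Lemma normr_step_fun c x : `|step_fun c x| = step_fun (fun i => `|c i|) x.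
Proof.
rewrite /step_fun.
have [[i ix]|nx] := pselect (exists i, cell i x); last first.
  rewrite !big1 ?normr0 // => i _; rewrite indicE memNset ?mulr0 //;
    by move=> ix; apply: nx; exists i.
have jx j : j != i -> \1_(cell j) x = 0 :> R.
  move=> ji; rewrite indicE memNset // => jx; move/eqP: ji; apply.
  exact: cell_disjoint jx ix.
rewrite (bigD1 i) //= [in RHS](bigD1 i) //= !big1 ?addr0; first last.
- by move=> j /jx ->; rewrite mulr0.
- by move=> j /jx ->; rewrite mulr0.
by rewrite indicE mem_set // !mulr1 normrM (ger0_norm (ler0n _ _)).
Qed.

Lemma measurable_step_fun c : measurable_fun setT (step_fun c).
Proof.
apply: measurable_sum => i; apply: measurable_funM => //.
by apply: measurable_indic; apply: measurable_cell.
Qed.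

Lemma integral_step_fun c : (forall i, 0 <= c i) ->
  (\int[lebesgue01 R]_x (step_fun c x)%:E = (\sum_(i < n) c i)%:E)%E.
Proof.
move=> c0; under eq_integral do rewrite /step_fun -sumEFin.
rewrite ge0_integral_sum //; last 2 first.
- move=> i; apply/measurable_EFinP; apply: measurable_funM => //.
  by apply: measurable_indic; apply: measurable_cell.
- by move=> i x _; rewrite lee_fin mulr_ge0 // ?mulr_ge0 // indicE ler0n.
rewrite -sumEFin; apply: eq_bigr => i _.
under eq_integral do rewrite EFinM.
rewrite ge0_integralZl //; first last.
- by rewrite lee_fin mulr_ge0.
- by apply/measurable_EFinP; apply: measurable_indic; apply: measurable_cell.
rewrite integral_indic ?setIT //; last exact: measurable_cell.
rewrite [X in (_ * X)%E]lebesgue01_cell -EFinM -mulrA mulfV ?mulr1 //.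
by rewrite pnatr_eq0; case: n i {c c0} => [[]|].
Qed.

Lemma Lnorm_step_fun c :
  ('N[lebesgue01 R]_1[EFin \o step_fun c] = (\sum_(i < n) `|c i|)%:E)%E.
Proof.
rewrite Lnorm1 -integral_step_fun; last by move=> i; apply: normr_ge0.
by apply: eq_integral => x _ /=; rewrite normr_step_fun.
Qed.

Lemma step_fun_Lfun c : step_fun c \in Lfun (lebesgue01 R) 1%E.
Proof.
apply/andP; split; rewrite inE /=; first exact: measurable_step_fun.
by rewrite /finite_norm Lnorm_step_fun ltry.
Qed.

End StepFunctions.

Lemma l1_embeds_L1 (R : realType) (M : Type) (J : finType) (v : M -> J -> R)
    (d : M -> M -> R) (s D : R) : 0 < s ->
  (forall x y, s * d x y <= \sum_j `|v x j - v y j| <= D * s * d x y) ->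
  embeds_L1 d D.
Proof.
move=> s0 vd; exists s, (fun x => step_fun (fun i : 'I_#|J| => v x (enum_val i))).
split=> // [x|x y]; first exact: step_fun_Lfun.
have -> : step_fun (fun i : 'I_#|J| => v x (enum_val i)) \-
    step_fun (fun i : 'I_#|J| => v y (enum_val i)) =
    step_fun (fun i : 'I_#|J| => v x (enum_val i) - v y (enum_val i)).
  apply/funext => t; rewrite /step_fun /= -sumrB; apply: eq_bigr => i _.
  by rewrite !mulrBl.
rewrite Lnorm_step_fun.
have := vd x y; rewrite (reindex _ (onW_bij _ (@enum_val_bij J))) /=.
by case/andP=> ? ?; split; rewrite lee_fin.
Qed.

(** * Lamplighter spaces *)

Section LampCode.
Variables (T : finType) (S : pred T).

Definition lamp_code (q : {set T} * T) : bool * {set T} :=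
  (S q.2, [set t in q.1 | S t != S q.2]).

(** If x and y are on the same side, the codes can differ only in a lamp of the symmetric difference
    on the other side. *)
Lemma lamp_code_neq A x B y : (lamp_code (A, x) != lamp_code (B, y)) =
  separates S (x |: (y |: symdiff A B)).
Proof.
apply/idP/separatesP => [|[u [v [uZ vZ uv]]]].
  rewrite xpair_eqE negb_and /=; have [Sxy|Sxy _] := eqVneq (S x) (S y); last first.
    by exists x, y; rewrite !inE !eqxx ?orbT.
  move=> /= /eqP AB; apply: contrapT => nsep; apply: AB; apply/setP => t.
  rewrite !inE Sxy; have [//|St] := eqVneq (S t) (S y); rewrite ?andbF //.
  rewrite !andbT; apply: contrapT => /eqP tAB; apply: nsep; exists t, y.
  split=> //; last by rewrite !inE eqxx orbT.
  rewrite !inE; apply/orP; right; apply/orP; right.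
  by case: (t \in A) (t \in B) tAB => [] [].
apply/eqP => -[Sxy /setP AB].
have same t : t \in x |: (y |: symdiff A B) -> S t = S y.
  rewrite !inE => /or3P[/eqP->//|/eqP->//|tAB].
  apply/eqP; have := AB t; rewrite !inE Sxy.
  by case: (S t == S y) tAB => //; rewrite !andbT; case: (t \in A) (t \in B) => [] [].
by move: uv; rewrite (same u) // (same v) // eqxx.
Qed.

End LampCode.

(** Distinct values differ in exactly two coordinates, whence the factor 1/2. *)
Lemma sum_indicator_dist (R : realType) (K : finType) (w : R) (a b : K) :
  0 <= w ->
  \sum_k `|w / 2 * (a == k)%:R - w / 2 * (b == k)%:R| = w * (a != b)%:R.
Proof.
move=> w0; have [->|ab] /= := eqVneq a b.
  by rewrite mulr0 big1 // => k _; rewrite subrr normr0.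
rewrite (bigD1 a) //= (bigD1 b) /=; last by rewrite eq_sym.
rewrite !eqxx [b == a]eq_sym (negbTE ab) big1 => [|k /andP[]].
  rewrite !mulr0 !mulr1 subr0 sub0r normrN !ger0_norm ?divr_ge0 //; lra.
by rewrite [k == a]eq_sym [k == b]eq_sym => /negbTE-> /negbTE->;
  rewrite subrr normr0.
Qed.

Section Lamplighter.
Variables (R : realType) (T X : finType) (d : T -> T -> R).
Variables (val : X -> T) (sec : T -> X) (J : finType) (p : J -> X -> X) (K : R).
Hypothesis md : is_metric d.
Hypothesis secK : cancel sec val.
Hypothesis J_gt0 : (0 < #|J|)%N.
Hypothesis K_ge1 : 1 <= K.
Hypothesis treeX : forall i, is_tree [set: X]%SET (p i).
Let dX u v := d (val u) (val v).
Hypothesis distX : forall x y,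
  \sum_i tree_dist [set: X]%SET (p i) dX (sec x) (sec y) <= K * #|J|%:R * d x y.

Let pd : pseudometric d. Proof. exact: metric_pseudometric. Qed.
Let pdX : pseudometric dX. Proof. exact: pseudometric_comp. Qed.

(** A pair (i, a) stands for the edge above a in the tree i; [side] pulls its cut back to T along
    [sec]. *)
Let weight (ia : J * X) : R := dX ia.2 (p ia.1 ia.2).
Let side (ia : J * X) : pred T := fun t => fconnect (p ia.1) (sec t) ia.2.

Let weight_ge0 ia : 0 <= weight ia. Proof. exact: pseudometric_ge0. Qed.

(** In each tree a walk of length at most 3 times the Steiner tree projects along [val] to a tour in
    T of the same length. *)
Lemma tsp_le_cuts x C y : #|J|%:R * tsp d x C y <=
  3 * \sum_ia weight ia * (separates (side ia) (x |: (y |: C)))%:R.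
Proof.
rewrite -(pair_bigA _ (fun i a =>
  weight (i, a) * (separates (side (i, a)) (x |: (y |: C)))%:R)) /=.
rewrite mulr_natl -sumr_const mulr_sumr; apply: ler_sum => i _.
have [|s [ls subs lens]] := @walk_steiner R X [set: X]%SET (p i) dX pdX (treeX i)
    (sec x) [set sec t | t in C]%SET (sec y); first exact: finset.subsetT.
have [_ /(_ (map val s)) le_tsp] := tsp_min x C y md.
apply: (@le_trans _ _ (walk_length d x (map val s))).
  apply: le_tsp; first by rewrite -{1}(secK x) last_map ls secK.
  move=> t tC; rewrite -(secK x) -(secK t) -map_cons map_f //.
  by apply: subs; apply: imset_f.
rewrite -{1}(secK x) walk_length_map; apply: le_trans lens _.
rewrite ler_pM2l // /steiner.
under [leLHS]eq_bigl do rewrite finset.in_setT.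
apply: ler_sum => a _.
apply: ler_wpM2l; first exact: pseudometric_ge0.
rewrite ler_nat -imsetU1 -imsetU1.
have [/separatesP[_ [_ [/imsetP[u uZ ->] /imsetP[v vZ ->] uv]]]|//] :=
  boolP (separates _ [set sec t | t in _]%SET).
by rewrite (introT (separatesP _ _)) //; exists u, v.
Qed.

(** An optimal tour crosses every separating cut, and the weighted crossings of one step add up to
    the tree distances bounded by [distX]. *)
Lemma cuts_le_tsp x C y :
  \sum_ia weight ia * (separates (side ia) (x |: (y |: C)))%:R <=
  K * #|J|%:R * tsp d x C y.
Proof.
have [[s [ls subs <-]] _] := tsp_min x C y md.
have Zs : {subset x |: (y |: C) <= x :: s}.
  move=> u; rewrite !inE => /or3P[/eqP->|/eqP->|/subs]; rewrite ?eqxx //.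
  by rewrite -in_cons -ls mem_last.
apply: (@le_trans _ _ (\sum_ia weight ia *
    walk_length (fun u v => (side ia u != side ia v)%:R) x s)).
  by apply: ler_sum => ia _; apply: ler_wpM2l => //; apply: separates_walk.
rewrite walk_length_sum; apply: le_walk_length => u v.
apply: le_trans (distX u v).
rewrite -(pair_bigA _ (fun i a =>
  weight (i, a) * (side (i, a) u != side (i, a) v)%:R)) /=.
apply: ler_sum => i _; rewrite /tree_dist.
by under [leRHS]eq_bigl do rewrite finset.in_setT.
Qed.

Lemma lamplighter_embeds : embeds_L1 (la_dist d) (3 * K).
Proof.
pose coord (q : {set T} * T) (j : (J * X) * (bool * {set T}) + T) : R :=
  match j with
  | inl c => weight c.1 / 2 * (lamp_code (side c.1) q == c.2)%:R
  | inr t => #|J|%:R * (t \in q.1)%:R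
  end.
(* The scale #|J| / 3 absorbs the 3 of [tsp_le_cuts]; the lamp coordinates have weight #|J| to match
   the sum over the trees. *)
apply: (@l1_embeds_L1 _ _ _ coord _ (#|J|%:R / 3)); first by rewrite divr_gt0 ?ltr0n.
move=> [A x] [B y]; rewrite big_sumType /= -(pair_bigA _ (fun ia c =>
  `|weight ia / 2 * (lamp_code (side ia) (A, x) == c)%:R
    - weight ia / 2 * (lamp_code (side ia) (B, y) == c)%:R|)) /=.
under eq_bigr do rewrite sum_indicator_dist // lamp_code_neq.
have -> : \sum_t `|#|J|%:R * (t \in A)%:R - #|J|%:R * (t \in B)%:R| =
    #|J|%:R * #|symdiff A B|%:R :> R.
  rewrite -sum1_card natr_sum [in RHS]big_mkcond mulr_sumr; apply: eq_bigr => t _ /=.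
  rewrite -mulrBr normrM (ger0_norm (ler0n _ _)) !inE; congr (_ * _).
  by case: (t \in A) (t \in B) => [] [] /=; rewrite ?subrr ?subr0 ?sub0r ?normrN
    ?normr0 ?normr1.
rewrite /la_dist /=; set C := symdiff A B.
have := tsp_le_cuts x C y; have := cuts_le_tsp x C y.
set S := \sum_ia _ => up lo.
have C0 : 0 <= #|J|%:R * #|C|%:R :> R by rewrite mulr_ge0.
have := ler_wpM2r C0 K_ge1.
by move=> CK; apply/andP; split; lra.
Qed.

End Lamplighter.

(** * Graphs of bounded pathwidth *)

Lemma pathwidth_decomposition (T : finType) (e : rel T) :
  exists2 P, path_decomposition e P & forall B, B \in P -> (#|B| <= (pathwidth e).+1)%N.
Proof.
rewrite /pathwidth; case: ex_minnP => n /asboolP[P dP <-] _; exists P => // B BP.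
rewrite /width; apply: leq_trans (leqSpred _).
by rewrite (big_rem B) //= leq_maxl.
Qed.

Section Copies.
Variables (R : realType) (T : finType) (e : rel T) (d : T -> T -> R).
Variables (t0 : T) (m k : nat) (P : seq {set T}).
Hypothesis md : is_metric d.
Hypothesis sd : supported_on e d.
Hypothesis decP : path_decomposition e P.
Hypothesis sizeP : size P = m.+1.
Hypothesis cardP : forall B, B \in P -> (#|B| <= k.+1)%N.

(* One vertex per layer and slot: the vertices of each bag are listed with
   padding, so that a vertex of G has one copy for each bag that contains it. *)
Definition copy_of (u : 'I_m.+1 * 'I_k.+1) : T :=
  nth t0 (enum (nth finset.set0 P u.1)) u.2.

Let X : finType := ('I_m.+1 * 'I_k.+1)%type.
Let lay (u : X) : nat := u.1.
Let bag (i : nat) : {set T} := nth finset.set0 P i.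

Lemma ex_copy i t : (i <= m)%N -> t \in bag i ->
  exists u : X, lay u = i /\ copy_of u = t.
Proof.
move=> im ti; have iP : (i < m.+1)%N by [].
have jk : (index t (enum (bag i)) < k.+1)%N.
  apply: leq_trans (cardP (mem_nth finset.set0 (_ : i < size P)%N)); last by rewrite sizeP.
  by rewrite cardE index_mem mem_enum.
exists (Ordinal iP, Ordinal jk); split=> //.
by rewrite /copy_of /= nth_index // mem_enum.
Qed.

Lemma ex_copies : exists sec : T -> X,
  cancel sec copy_of /\ forall t, t \in bag (lay (sec t)).
Proof.
case: decP => cov _ _.
suff /choice[sec secP] : forall t, exists u : X, copy_of u = t /\ t \in bag (lay u).
  by exists sec; split=> t; case: (secP t).
move=> t; have [B BP tB] := cov t; have [|//|u [ui ut]] := @ex_copy (index B P) t.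
- by rewrite -ltnS -sizeP index_mem.
- by rewrite /bag nth_index.
by exists u; rewrite ui /bag nth_index.
Qed.

Variables (sigma : X -> X -> R) (K : R).
Hypothesis psigma : pseudometric sigma.
Hypothesis K_ge0 : 0 <= K.
Hypothesis sigmaK : forall u v, adjacent_layers lay u v ->
  sigma u v <= K * d (copy_of u) (copy_of v).

Let sC u v : sigma u v = sigma v u. Proof. by case: psigma. Qed.
Let stri u v w : sigma u w <= sigma u v + sigma v w.
Proof. by case: psigma. Qed.

(** The bags that contain t are consecutive, so a chain of copies of t through successive layers
    joins u to v, and each step costs at most K * d t t = 0. *)
Lemma copies_dist t u v : copy_of u = t -> copy_of v = t ->
  t \in bag (lay u) -> t \in bag (lay v) -> sigma u v <= 0.
Proof.
have [d0 _ _ _] := md.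
wlog uv : u v / (lay u <= lay v)%N => [H ut vt ub vb|].
  by have [/H->//|/ltnW/H] := leqP (lay u) (lay v); rewrite sC; apply.
move vn: (lay v - lay u)%N => n; elim: n v uv vn => [|n IH] v uv vn ut vt ub vb.
  apply: le_trans (sigmaK _) _; last by rewrite ut vt d0 mulr0.
  by rewrite /adjacent_layers; lia.
have lv : (lay v <= m)%N by rewrite /lay -ltnS.
have tb : t \in bag (lay v).-1.
  case: decP => _ _ /(_ (lay u) (lay v).-1 (lay v)) betw.
  by apply: (fintype.subsetP (betw _ _)); rewrite ?sizeP ?inE ?ub //; lia.
have [|w [wl wt]] := ex_copy _ tb; first by lia.
apply: le_trans (stri u w v) _; rewrite -[leRHS]addr0; apply: lerD.
  by apply: IH; rewrite ?wl //; lia.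
apply: le_trans (sigmaK _) _; last by rewrite wt vt d0 mulr0.
by rewrite /adjacent_layers wl; lia.
Qed.

(** The ends of an edge share a bag, and moving to their copies in that layer is free; a shortest
    path reduces the general case to edges. *)
Lemma copies_lipschitz sec : cancel sec copy_of ->
  (forall t, t \in bag (lay (sec t))) ->
  forall x y, sigma (sec x) (sec y) <= K * d x y.
Proof.
move=> secK secP.
have edge x y : e x y -> sigma (sec x) (sec y) <= K * d x y.
  move=> exy; case: decP => _ /(_ x y exy)[B [BP xB yB]] _.
  have iB : (index B P <= m)%N by rewrite -ltnS -sizeP index_mem.
  have bB : bag (index B P) = B by rewrite /bag nth_index.
  have [u [ui ux]] : exists u : X, lay u = index B P /\ copy_of u = x.
    by apply: ex_copy; rewrite ?bB.
  have [v [vi vy]] : exists u : X, lay u = index B P /\ copy_of u = y.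
    by apply: ex_copy; rewrite ?bB.
  have xu : sigma (sec x) u <= 0 by apply: (@copies_dist x); rewrite ?ui ?bB.
  have vy' : sigma v (sec y) <= 0 by apply: (@copies_dist y); rewrite ?vi ?bB.
  have uv : sigma u v <= K * d x y.
    by rewrite -ux -vy; apply: sigmaK; rewrite /adjacent_layers ui vi; lia.
  by have := stri (sec x) u (sec y); have := stri u v (sec y); lra.
case: sd => w [_ _ sp dw] x y; have [[s [es <- <-]] _] := sp x y.
elim: s x es => /= [|z s IH] x.
  by move=> _; rewrite mulr0; case: psigma => ->.
case/andP=> exz /IH le_s; rewrite mulrDr; apply: le_trans (stri _ (sec z) _) _.
by rewrite lerD // -dw // edge.
Qed.

End Copies.

Theorem corollary11 (R : realType) (k : nat) (hk : (2 <= k)%N) :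
  exists C : R,
    forall (T : finType) (e : rel T) (d : T -> T -> R),
      symmetric e -> irreflexive e -> pathwidth e = k ->
      is_metric d -> supported_on e d ->
      embeds_L1 (la_dist d) C.
Proof.
(* Bags have at most k + 1 vertices, so there are k + 1 points per layer and one factor 55 for each;
   the 3 comes from the tours. *)
exists (3 * 55 ^+ k.+1) => T e d _ _ ek md sd.
have [t0 _|T0] := pickP (@predT T); last first.
  by exists 1, (fun _ _ => 0); split=> // -[A x]; have := T0 x.
have [P decP cardP] := pathwidth_decomposition e; rewrite ek in cardP.
have [m sizeP] : exists m, size P = m.+1.
  case: decP => cov _ _; have [B + _] := cov t0.
  by case: (P) => // B' P' _; exists (size P').
have [sec [secK secP]] := ex_copies t0 decP sizeP cardP.
pose X : finType := ('I_m.+1 * 'I_k.+1)%type.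
pose dX (u v : X) := d (copy_of t0 P u) (copy_of t0 P v).
have pdX : pseudometric dX.
  exact/pseudometric_comp/metric_pseudometric.
have [||J [p [J0 treeX distX]]] :=
  @layered_trees R X (fun u => u.1) m k.+1 dX [set: X]%SET pdX.
- by move=> u _; rewrite -ltnS.
(* Thanks to the padding every layer has exactly k + 1 points. *)
- move=> i im; have iP : (i < m.+1)%N by [].
  rewrite -[RHS]card_ord -(card_imset _ (f := fun j => (Ordinal iP, j) : X)).
    apply: eq_card => -[a b]; rewrite !inE /=; apply/eqP/imsetP => [ai|[c _ [-> _]]//].
    by exists b => //; congr pair; apply: val_inj.
  by move=> j j' [].
have ge1 : 1 <= 55 ^+ k.+1 :> R by rewrite exprn_ege1 // ler1n.
apply: (@lamplighter_embeds R T X d (copy_of t0 P) sec J p) => //.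
pose s (u v : X) := \sum_i tree_dist [set: X]%SET (p i) dX u v.
have ps : pseudometric s.
  by apply: pseudometric_sum => i; apply: tree_dist_pseudometric.
apply: (copies_lipschitz md sd decP sizeP cardP ps) => // u v uv.
by apply: distX; rewrite ?finset.in_setT.
Qed.
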